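(* Let $q$ be a nonzero complex number with $|q|<1$, let $m$ be a nonnegative integer, and let $a,b,z$ be complex parameters such that all expressions below are well defined (no division by zero occurs). If $|z|<1$, then $$ \sum_{k=-m}^{\infty}\frac{(a;q)_k\,(bq^{m}/az;q)_k}{(q^{1+m};q)_k\,(b;q)_k}\,z^k =\frac{(q;q)_m\,(q/az;q)_m}{(q/a;q)_m\,(b/az;q)_m}\cdot \frac{(b/a;q)_{\infty}\,(az;q)_{\infty}}{(b;q)_{\infty}\,(z;q)_{\infty}}. $$
   Context: For $|q|<1$, $(x;q)_\infty=\prod_{i\ge 0}(1-xq^i)$, and for any integer $n$, $(x;q)_n=(x;q)_\infty/(xq^n;q)_\infty$. Thus for $n\ge 0$, $(x;q)_n=\prod_{i=0}^{n-1}(1-xq^i)$ and $(x;q)_{-n}=\dfrac{1}{(xq^{-n};q)_n}=\dfrac{(-q/x)^n q^{\binom n2}}{(q/x;q)_n}$. Expressions such as $bq^m/az$, $q/az$, $b/az$ mean $bq^m/(az)$, $q/(az)$, $b/(az)$. *)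

(* Defs.v *)
From Stdlib Require Import Reals ZArith Lra Lia.
From Coquelicot Require Import Coquelicot.

Open Scope C_scope.

Definition Cpowz (x : C) (k : Z) : C :=
  if (0 <=? k)%Z then x ^ Z.to_nat k else / x ^ Z.to_nat (- k).

Fixpoint qpoch_nat (x q : C) (n : nat) : C :=
  match n with
  | O => 1
  | S n' => qpoch_nat x q n' * (1 - x * q ^ n')
  end.

Definition qpoch_inf (x q : C) : C :=
  iota (T := C_CompleteNormedModule)
    (fun l : C => filterlim (qpoch_nat x q) eventually (locally l)).

(* The quotient (x;q)_oo / (x q^k;q)_oo is 0/0 when x = q^(-N) and
   0 <= k <= N, although (x;q)_k is then a perfectly good finite product.
   Hence the finite forms are taken as the definition; [qpoch_ratio] below
   recovers the quotient whenever it makes sense. *)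
Definition qpoch (x q : C) (k : Z) : C :=
  if (0 <=? k)%Z then qpoch_nat x q (Z.to_nat k)
  else / qpoch_nat (x * Cpowz q k) q (Z.to_nat (- k)).

Lemma qpoch_nat_bound (x q : C) (n : nat) : (Cmod q < 1)%R ->
  (Cmod (qpoch_nat x q n) <= exp (Cmod x * (1 - Cmod q ^ n) / (1 - Cmod q)))%R.
Proof.
intros Hq; induction n as [|n IH].
- simpl; rewrite Cmod_1.
  replace (Cmod x * (1 - 1) / (1 - Cmod q))%R with 0%R by (field; lra).
  rewrite exp_0; lra.
- simpl qpoch_nat; rewrite Cmod_mult.
  replace (Cmod x * (1 - Cmod q ^ S n) / (1 - Cmod q))%R
    with (Cmod x * (1 - Cmod q ^ n) / (1 - Cmod q) + Cmod x * Cmod q ^ n)%R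
    by (simpl; field; lra).
  rewrite exp_plus.
  apply Rmult_le_compat; try apply Cmod_ge_0; auto.
  apply Rle_trans with (1 + Cmod x * Cmod q ^ n)%R.
  + unfold Cminus; eapply Rle_trans; [apply Cmod_triangle|].
    rewrite Cmod_1, Cmod_opp, Cmod_mult, Cmod_pow; lra.
  + apply exp_ineq1_le.
Qed.

Lemma qpoch_nat_ex_lim (x q : C) : (Cmod q < 1)%R ->
  exists l : C, filterlim (qpoch_nat x q) eventually (locally l).
Proof.
intros Hq.
assert (H0 := Cmod_ge_0 q).
assert (H0x := Cmod_ge_0 x).
set (M := exp (Cmod x / (1 - Cmod q))).
assert (HM : forall n, (Cmod (qpoch_nat x q n) <= M)%R).
{ intros n; eapply Rle_trans; [apply qpoch_nat_bound; auto|].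
  assert (Hp : (0 <= Cmod q ^ n)%R) by (apply pow_le; auto).
  assert (Hle : (Cmod x * (1 - Cmod q ^ n) / (1 - Cmod q)
                 <= Cmod x / (1 - Cmod q))%R).
  { unfold Rdiv; apply Rmult_le_compat_r.
    - left; apply Rinv_0_lt_compat; lra.
    - nra. }
  unfold M; destruct Hle as [Hlt|Heq].
  - left; apply exp_increasing; auto.
  - rewrite Heq; lra. }
assert (Hex : ex_series (V := C_CompleteNormedModule)
                (fun n => - (qpoch_nat x q n * (x * q ^ n)))).
{ apply (ex_series_le (K := C_AbsRing) (V := C_CompleteNormedModule) _
           (fun n => (M * Cmod x) * Cmod q ^ n)%R).
  - intros n; change (Cmod (- (qpoch_nat x q n * (x * q ^ n)))
                        <= M * Cmod x * Cmod q ^ n)%R.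
    rewrite Cmod_opp, !Cmod_mult, Cmod_pow, <- Rmult_assoc.
    apply Rmult_le_compat_r; [apply pow_le; auto|].
    apply Rmult_le_compat_r; auto.
  - apply (ex_series_scal_l (K := R_AbsRing) (M * Cmod x)%R (fun n => Cmod q ^ n)%R).
    apply ex_series_geom; rewrite Rabs_pos_eq; auto. }
destruct Hex as [l Hl].
exists (l + 1).
assert (Hs : forall n,
  plus (sum_n (G := C_AbelianMonoid)
          (fun n => - (qpoch_nat x q n * (x * q ^ n))) n) (1 : C)
  = qpoch_nat x q (S n)).
{ induction n as [|n IH].
  - rewrite sum_O.
    change (- (1 * (x * 1)) + 1 = 1 * (1 - x * 1)); ring.
  - rewrite sum_Sn.
    change plus with Cplus in *.
    set (s := sum_n _ n) in *; clearbody s.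
    change (s + - (qpoch_nat x q (S n) * (x * q ^ S n)) + 1
            = qpoch_nat x q (S n) * (1 - x * q ^ S n)).
    change (s + 1 = qpoch_nat x q (S n)) in IH.
    change C in s; rewrite <- IH; ring. }
assert (HS : filterlim (fun n => qpoch_nat x q (S n)) eventually
               (locally (l + 1))).
{ eapply filterlim_ext; [exact Hs|].
  eapply filterlim_comp_2; [exact Hl|apply filterlim_const|].
  apply (filterlim_plus (K := C_AbsRing) (V := C_NormedModule) l (1 : C)). }
intros P HP; destruct (HS P HP) as [N HN].
exists (S N); intros [|n] Hn; [lia|]; apply HN; lia.
Qed.

Lemma qpoch_inf_correct (x q : C) : (Cmod q < 1)%R ->
  filterlim (qpoch_nat x q) eventually (locally (qpoch_inf x q)).
Proof.
intros Hq; destruct (qpoch_nat_ex_lim x q Hq) as [l Hl].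
assert (E : qpoch_inf x q = l).
{ exact (iota_filterlim_locally (K := C_AbsRing) (V := C_CompleteNormedModule)
           (F := eventually) (qpoch_nat x q) l Hl). }
rewrite E; exact Hl.
Qed.

Lemma qpoch_nat_add (x q : C) (n p : nat) :
  qpoch_nat x q (n + p) = qpoch_nat x q n * qpoch_nat (x * q ^ n) q p.
Proof.
induction p as [|p IH].
- rewrite Nat.add_0_r; simpl; ring.
- rewrite Nat.add_succ_r; simpl; rewrite IH, Cpow_add_r; ring.
Qed.

Lemma qpoch_inf_split (x q : C) (n : nat) : (Cmod q < 1)%R ->
  qpoch_inf x q = qpoch_nat x q n * qpoch_inf (x * q ^ n) q.
Proof.
intros Hq.
apply (filterlim_locally_unique (K := C_AbsRing) (V := C_NormedModule)
         (F := eventually) (fun p => qpoch_nat x q (n + p))).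
- intros P HP; destruct (qpoch_inf_correct x q Hq P HP) as [N HN].
  exists N; intros p Hp; apply HN; lia.
- eapply filterlim_ext; [intros p; symmetry; apply qpoch_nat_add|].
  eapply filterlim_comp; [apply qpoch_inf_correct, Hq|].
  apply (filterlim_scal_r (K := C_AbsRing) (V := C_NormedModule)).
Qed.

Lemma qpoch_ratio (x q : C) (k : Z) :
  q <> 0 -> (Cmod q < 1)%R -> qpoch_inf (x * Cpowz q k) q <> 0 ->
  qpoch x q k = qpoch_inf x q / qpoch_inf (x * Cpowz q k) q.
Proof.
intros Hq0 Hq; unfold qpoch.
destruct (Z.leb_spec 0 k) as [Hk|Hk].
- unfold Cpowz; rewrite (proj2 (Z.leb_le _ _) Hk); intros Hn.
  rewrite (qpoch_inf_split x q (Z.to_nat k) Hq); field; exact Hn.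
- intros Hn.
  assert (He : x * Cpowz q k * q ^ Z.to_nat (- k) = x).
  { unfold Cpowz; rewrite (proj2 (Z.leb_gt _ _) Hk).
    field; apply Cpow_nz, Hq0. }
  assert (Hs := qpoch_inf_split (x * Cpowz q k) q (Z.to_nat (- k)) Hq).
  rewrite He in Hs; rewrite Hs in Hn |- *.
  field; split; intros H0; apply Hn; rewrite H0; ring.
Qed.

(* Main.v *)
Require Import Defs.
From Stdlib Require Import Reals ZArith Lra Lia.
From Coquelicot Require Import Coquelicot.
Open Scope C_scope.

(** The bilateral sum has finitely many terms of negative index, so shifting
    the index by [m] makes it one-sided.  By [qpoch_sub],
    (y q^m;q)_(j-m) = (y;q)_j / (y;q)_m, which turns the summand into a
    constant times
      (A;q)_j (B;q)_j / ((q;q)_j (ABz;q)_j) z^j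
    with A = a q^(-m), B = b/(az) and ABz = b q^(-m).  This is the term of the
    series 2phi1(A,B;C;q,z) at the argument z = C/(AB), where the q-Gauss sum
    applies:
      sum_j (A)_j (B)_j / ((q)_j (ABz)_j) z^j
        = (Az)_oo (Bz)_oo / ((ABz)_oo (z)_oo).
    Taking z rather than C as the free parameter keeps the formula meaningful
    when A or B vanishes, so that b = 0 needs no separate treatment.  The
    surplus factor (a z q^(-m);q)_m, and (a q^(-m);q)_m from the shift, are
    reflected into (q/(az);q)_m and (q/a;q)_m by [qpoch_nat_reflect].

    The q-Gauss sum itself [q_gauss_sum] is proved without rearranging a
    double series.  Write F(z) for the sum.  A telescoping certificate
    [gauss_term_contiguous] gives
      (1 - ABz) (1 - z) F(z) = (1 - Az) (1 - Bz) F(qz),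
    hence (ABz)_n (z)_n F(z) = (Az)_n (Bz)_n F(z q^n) for all n.  Letting n
    tend to infinity, F(z q^n) tends to 1 by the term bound [gauss_term_le],
    which is uniform in n although the denominators (ABz q^n;q)_j move with n.
    Dividing by (z)_oo is possible since (x;q)_oo cannot vanish for |x| < 1
    [qpoch_inf_neq0]. *)

(** * Limits of complex sequences *)

(** Reduces complex limits to real ones, where the squeeze theorem and the
    arithmetic of limits are at hand. *)
Lemma filterlim_Cmod_iff (u : nat -> C) (l : C) :
  filterlim u eventually (locally l)
  <-> is_lim_seq (fun n => Cmod (u n - l)) 0%R.
Proof.
rewrite (filterlim_locally_ball_norm (K := C_AbsRing) (U := C_NormedModule)).
rewrite <- is_lim_seq_spec.
split; intros H eps; destruct (H eps) as [N HN]; exists N; intros n Hn;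
  specialize (HN n Hn).
- change (Cmod (u n - l) < eps)%R in HN.
  rewrite Rminus_0_r, Rabs_pos_eq; [exact HN|apply Cmod_ge_0].
- change (Cmod (u n - l) < eps)%R.
  rewrite Rminus_0_r, Rabs_pos_eq in HN; [exact HN|apply Cmod_ge_0].
Qed.

Lemma filterlim_Cmod (u : nat -> C) (l : C) :
  filterlim u eventually (locally l) ->
  is_lim_seq (fun n => Cmod (u n)) (Cmod l).
Proof.
intros H; eapply filterlim_comp; [exact H|].
apply (filterlim_norm (K := C_AbsRing) (V := C_NormedModule)).
Qed.

Lemma filterlim_Cmod_le (u : nat -> C) (l c : C) (B : R) :
  filterlim u eventually (locally l) ->
  (forall n, (Cmod (u n - c) <= B)%R) -> (Cmod (l - c) <= B)%R.
Proof.
intros Hu HB.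
assert (H : filterlim (fun n => u n - c) eventually (locally (l - c))).
{ apply filterlim_Cmod_iff; apply filterlim_Cmod_iff in Hu.
  eapply is_lim_seq_ext; [|exact Hu].
  intros n; simpl; f_equal; ring. }
exact (is_lim_seq_le _ _ _ _ HB (filterlim_Cmod _ _ H) (is_lim_seq_const B)).
Qed.

Lemma filterlim_Cmult (u v : nat -> C) (l k : C) :
  filterlim u eventually (locally l) -> filterlim v eventually (locally k) ->
  filterlim (fun n => u n * v n) eventually (locally (l * k)).
Proof.
intros Hu Hv.
assert (Hv' := filterlim_Cmod _ _ Hv).
apply filterlim_Cmod_iff in Hu; apply filterlim_Cmod_iff in Hv.
apply filterlim_Cmod_iff.
apply is_lim_seq_le_le with (u := fun _ => 0%R)
  (w := fun n => (Cmod (u n - l) * Cmod (v n) + Cmod l * Cmod (v n - k))%R).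
- intros n; split; [apply Cmod_ge_0|].
  replace (u n * v n - l * k) with ((u n - l) * v n + l * (v n - k)) by ring.
  eapply Rle_trans; [apply Cmod_triangle|].
  rewrite !Cmod_mult; lra.
- apply is_lim_seq_const.
- replace (Finite 0) with (Finite (0 * Cmod k + Cmod l * 0))
    by (f_equal; ring).
  apply is_lim_seq_plus'.
  + apply is_lim_seq_mult'; assumption.
  + apply is_lim_seq_mult'; [apply is_lim_seq_const|assumption].
Qed.

(** * Bounds on q-shifted factorials *)

Lemma Cmod_pow_le_1 (q : C) (n : nat) : (Cmod q < 1)%R ->
  (0 <= Cmod q ^ n <= 1)%R.
Proof.
intros Hq; assert (H := Cmod_ge_0 q); split; [apply pow_le, H|].
rewrite <- (pow1 n); apply pow_incr; lra.
Qed.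

(** A bound, uniform in [n], for the partial products: each factor satisfies
    |1 - x q^i| <= exp (|x| |q|^i), and the exponents form a geometric
    series. *)
Definition qpoch_majorant (x q : C) : R := exp (Cmod x / (1 - Cmod q)).

Lemma qpoch_majorant_pos (x q : C) : (0 < qpoch_majorant x q)%R.
Proof. apply exp_pos. Qed.

Lemma exp_le (x y : R) : (x <= y)%R -> (exp x <= exp y)%R.
Proof.
intros [H|H]; [left; apply exp_increasing, H|right; now rewrite H].
Qed.

Lemma geom_partial_le (r s : R) (n : nat) :
  (0 <= r)%R -> (0 <= s < 1)%R -> (r * (1 - s ^ n) / (1 - s) <= r / (1 - s))%R.
Proof.
intros Hr Hs.
assert (Hp : (0 <= s ^ n)%R) by (apply pow_le; lra).
apply Rmult_le_compat_r; [left; apply Rinv_0_lt_compat; lra|nra].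
Qed.

Lemma qpoch_nat_le_majorant (x q : C) (n : nat) : (Cmod q < 1)%R ->
  (Cmod (qpoch_nat x q n) <= qpoch_majorant x q)%R.
Proof.
intros Hq; eapply Rle_trans; [apply qpoch_nat_bound, Hq|].
apply exp_le, geom_partial_le; [apply Cmod_ge_0|].
split; [apply Cmod_ge_0|exact Hq].
Qed.

Lemma qpoch_inf_le_majorant (x q : C) : (Cmod q < 1)%R ->
  (Cmod (qpoch_inf x q) <= qpoch_majorant x q)%R.
Proof.
intros Hq.
exact (is_lim_seq_le _ _ _ _
  (fun n => qpoch_nat_le_majorant x q n Hq)
  (filterlim_Cmod _ _ (qpoch_inf_correct x q Hq))
  (is_lim_seq_const _)).
Qed.

Lemma qpoch_majorant_shift (x q : C) (n : nat) : (Cmod q < 1)%R ->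
  (qpoch_majorant (x * q ^ n) q <= qpoch_majorant x q)%R.
Proof.
intros Hq; apply exp_le.
apply Rmult_le_compat_r; [left; apply Rinv_0_lt_compat; lra|].
rewrite Cmod_mult, Cmod_pow.
assert (H := Cmod_ge_0 x); assert (Hn := Cmod_pow_le_1 q n Hq); nra.
Qed.

Lemma qpoch_nat_neq0 (x q : C) (n : nat) : (Cmod q < 1)%R ->
  qpoch_inf x q <> 0 -> qpoch_nat x q n <> 0.
Proof.
intros Hq Hx H0; apply Hx; rewrite (qpoch_inf_split x q n Hq), H0; ring.
Qed.

(** Lower bounds for partial products come from upper bounds for the rest:
    in (x)_oo = (x)_n (x q^n)_j (x q^(n+j))_oo the two outer factors are at
    most the majorant.  Uniformity in [n] as well as [j] is what the limit
    of the q-Gauss sum at z q^n requires. *)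
Lemma qpoch_nat_shift_ge (x q : C) (n j : nat) : (Cmod q < 1)%R ->
  (Cmod (qpoch_inf x q)
   <= Cmod (qpoch_nat (x * q ^ n) q j) * qpoch_majorant x q ^ 2)%R.
Proof.
intros Hq.
rewrite (qpoch_inf_split x q (n + j) Hq), qpoch_nat_add, !Cmod_mult.
assert (H1 := qpoch_nat_le_majorant x q n Hq).
assert (H2 := Rle_trans _ _ _ (qpoch_inf_le_majorant (x * q ^ (n + j)) q Hq)
                (qpoch_majorant_shift x q (n + j) Hq)).
assert (H3 := Cmod_ge_0 (qpoch_nat x q n)).
assert (H4 := Cmod_ge_0 (qpoch_nat (x * q ^ n) q j)).
assert (H5 := Cmod_ge_0 (qpoch_inf (x * q ^ (n + j)) q)).
replace (Cmod (qpoch_nat x q n) * Cmod (qpoch_nat (x * q ^ n) q j)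
         * Cmod (qpoch_inf (x * q ^ (n + j)) q))%R
  with (Cmod (qpoch_nat (x * q ^ n) q j)
        * (Cmod (qpoch_nat x q n) * Cmod (qpoch_inf (x * q ^ (n + j)) q)))%R
  by ring.
apply Rmult_le_compat_l; [exact H4|].
simpl; rewrite Rmult_1_r; apply Rmult_le_compat; assumption.
Qed.

(** From 1/(1-t) = 1 + t/(1-t) <= exp (t/(1-t)); relaxing 1-t to 1-r makes
    the exponent linear in [t], hence summable along a product. *)
Lemma one_minus_ge_exp (t r : R) :
  (0 <= t <= r)%R -> (r < 1)%R -> (exp (- (t / (1 - r))) <= 1 - t)%R.
Proof.
intros Ht Hr.
rewrite exp_Ropp.
assert (H1 : (1 + t / (1 - r) <= exp (t / (1 - r)))%R) by apply exp_ineq1_le.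
assert (H2 : (1 <= (1 - t) * (1 + t / (1 - r)))%R).
{ replace ((1 - t) * (1 + t / (1 - r)))%R
    with (1 + t * (r - t) / (1 - r))%R by (field; lra).
  assert (0 <= t * (r - t) / (1 - r))%R; [|lra].
  apply Rmult_le_pos; [nra|left; apply Rinv_0_lt_compat; lra]. }
assert (Hp := exp_pos (t / (1 - r))).
apply Rmult_le_reg_r with (exp (t / (1 - r))); [exact Hp|].
rewrite Rinv_l by lra; nra.
Qed.

Lemma qpoch_nat_ge (x q : C) (n : nat) : (Cmod q < 1)%R -> (Cmod x < 1)%R ->
  (exp (- (Cmod x / (1 - Cmod x) * (1 - Cmod q ^ n) / (1 - Cmod q)))
   <= Cmod (qpoch_nat x q n))%R.
Proof.
intros Hq Hx.
assert (H0q := Cmod_ge_0 q); assert (H0x := Cmod_ge_0 x).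
induction n as [|n IH].
- simpl; rewrite Cmod_1.
  replace (- (Cmod x / (1 - Cmod x) * (1 - 1) / (1 - Cmod q)))%R
    with 0%R by (field; lra).
  rewrite exp_0; lra.
- simpl qpoch_nat; rewrite Cmod_mult.
  assert (Hp := Cmod_pow_le_1 q n Hq).
  replace (- (Cmod x / (1 - Cmod x) * (1 - Cmod q ^ S n) / (1 - Cmod q)))%R
    with (- (Cmod x / (1 - Cmod x) * (1 - Cmod q ^ n) / (1 - Cmod q))
          + - (Cmod x * Cmod q ^ n / (1 - Cmod x)))%R
    by (simpl; field; lra).
  rewrite exp_plus.
  apply Rmult_le_compat; try (left; apply exp_pos); [exact IH|].
  eapply Rle_trans; [apply one_minus_ge_exp; [split; nra|exact Hx]|].
  assert (Ht := Cmod_triangle (1 - x * q ^ n) (x * q ^ n)).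
  replace (1 - x * q ^ n + x * q ^ n) with (1 : C) in Ht by ring.
  rewrite Cmod_1, Cmod_mult, Cmod_pow in Ht; lra.
Qed.

(** The partial products stay above a fixed positive exponential, so their
    limit does too. *)
Lemma qpoch_inf_neq0 (x q : C) :
  (Cmod q < 1)%R -> (Cmod x < 1)%R -> qpoch_inf x q <> 0.
Proof.
intros Hq Hx H0.
assert (H : (exp (- (Cmod x / (1 - Cmod x) / (1 - Cmod q)))
             <= Cmod (qpoch_inf x q))%R).
{ refine (is_lim_seq_le _ _ _ _ _ (is_lim_seq_const _)
            (filterlim_Cmod _ _ (qpoch_inf_correct x q Hq))).
  intros n; eapply Rle_trans; [|apply qpoch_nat_ge; assumption].
  apply exp_le, Ropp_le_contravar, geom_partial_le.
  - apply Rmult_le_pos; [apply Cmod_ge_0|left; apply Rinv_0_lt_compat; lra].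
  - split; [apply Cmod_ge_0|exact Hq]. }
rewrite H0, Cmod_0 in H.
assert (Hp := exp_pos (- (Cmod x / (1 - Cmod x) / (1 - Cmod q)))); lra.
Qed.

(** * The q-Gauss sum *)

(** The term of 2phi1(A,B;C;q,z) with C = ABz, the argument z = C/(AB) at
    which the series is summable in closed form. *)
Definition gauss_term (A B q z : C) (j : nat) : C :=
  qpoch_nat A q j * qpoch_nat B q j
  / (qpoch_nat q q j * qpoch_nat (A * B * z) q j) * z ^ j.

Lemma gauss_term_0 (A B q z : C) : gauss_term A B q z 0 = 1.
Proof. unfold gauss_term; simpl; field. Qed.

(** A telescoping certificate g_j = (1 - q^j) f_j, with f_j the term at [z].
    Since (ABzq)_j = (ABz)_j (1 - ABz q^j) / (1 - ABz) and f_(j+1) / f_j is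
    rational in Q = q^j, both sides are f_j times rational functions of Q;
    clearing denominators leaves
      (1 - z)(1 - ABzQ) - (1 - Az)(1 - Bz) Q
        = (1 - Q)(1 - ABzQ) - z (1 - AQ)(1 - BQ). *)
Lemma gauss_term_contiguous (A B q z : C) (j : nat) : (Cmod q < 1)%R ->
  qpoch_inf (A * B * z) q <> 0 ->
  (1 - A * B * z) * (1 - z) * gauss_term A B q z j
  - (1 - A * z) * (1 - B * z) * gauss_term A B q (z * q) j
  = (1 - A * B * z)
    * ((1 - q ^ j) * gauss_term A B q z j
       - (1 - q ^ S j) * gauss_term A B q z (S j)).
Proof.
intros Hq Hc.
assert (Hqj := qpoch_nat_neq0 q q (S j) Hq (qpoch_inf_neq0 q q Hq Hq)).
assert (Hcj := qpoch_nat_neq0 _ q (S j) Hq Hc).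
assert (Hs := qpoch_nat_add (A * B * z) q 1 j).
change (1 + j)%nat with (S j) in Hs.
unfold gauss_term.
replace (A * B * (z * q)) with (A * B * z * q ^ 1) by (simpl; ring).
rewrite Hs in Hcj.
assert (Hc1 : 1 - A * B * z <> 0).
{ intros H; apply Hcj; simpl.
  replace (A * B * z * 1) with (A * B * z) by ring; rewrite H; ring. }
assert (Hcq : qpoch_nat (A * B * z * q ^ 1) q j <> 0).
{ intros H; apply Hcj; rewrite H; ring. }
rewrite <- Hs in Hcj.
simpl in Hqj, Hcj.
assert (Hqj0 : qpoch_nat q q j <> 0) by (intros H; apply Hqj; rewrite H; ring).
assert (Hqj1 : 1 - q * q ^ j <> 0) by (intros H; apply Hqj; rewrite H; ring).
assert (Hcj0 : qpoch_nat (A * B * z) q j <> 0)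
  by (intros H; apply Hcj; rewrite H; ring).
assert (Hcj1 : 1 - A * B * z * q ^ j <> 0)
  by (intros H; apply Hcj; rewrite H; ring).
assert (E : qpoch_nat (A * B * z * q ^ 1) q j
            = qpoch_nat (A * B * z) q j * (1 - A * B * z * q ^ j)
              / (1 - A * B * z)).
{ change (qpoch_nat (A * B * z) q j * (1 - A * B * z * q ^ j))
    with (qpoch_nat (A * B * z) q (S j)).
  rewrite Hs; simpl; field; exact Hc1. }
rewrite E, Cpow_mult_l; simpl.
field; repeat split; assumption.
Qed.

Lemma gauss_partial_sum_contiguous (A B q z : C) (N : nat) : (Cmod q < 1)%R ->
  qpoch_inf (A * B * z) q <> 0 ->
  (1 - A * B * z) * (1 - z) * sum_n (gauss_term A B q z) N
  - (1 - A * z) * (1 - B * z) * sum_n (gauss_term A B q (z * q)) N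
  = - ((1 - A * B * z) * (1 - q ^ S N)) * gauss_term A B q z (S N).
Proof.
intros Hq Hc; induction N as [|N IH].
- rewrite !sum_O, gauss_term_contiguous by assumption; simpl; ring.
- rewrite !sum_Sn; change plus with Cplus.
  set (s := sum_n (gauss_term A B q z) N) in *.
  set (s' := sum_n (gauss_term A B q (z * q)) N) in *.
  clearbody s s'; change C in s, s'.
  assert (T := gauss_term_contiguous A B q z (S N) Hq Hc).
  set (f := gauss_term A B q z (S N)) in *.
  set (f' := gauss_term A B q (z * q) (S N)) in *.
  set (g := gauss_term A B q z (S (S N))) in *.
  transitivity (((1 - A * B * z) * (1 - z) * s - (1 - A * z) * (1 - B * z) * s')
    + ((1 - A * B * z) * (1 - z) * f - (1 - A * z) * (1 - B * z) * f'));
    [ring|rewrite IH, T; ring].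
Qed.

(** The constant [K] does not depend on [n]: this serves both the convergence
    of the series (n = 0) and its limit along z q^n. *)
Lemma gauss_term_le (A B q z : C) : (Cmod q < 1)%R ->
  qpoch_inf (A * B * z) q <> 0 ->
  exists K : R, (0 <= K)%R /\ forall n j : nat,
    (Cmod (gauss_term A B q (z * q ^ n) j) <= K * (Cmod z * Cmod q ^ n) ^ j)%R.
Proof.
intros Hq Hc.
assert (Hqq := qpoch_inf_neq0 q q Hq Hq).
set (c := A * B * z) in *.
exists (qpoch_majorant A q * qpoch_majorant B q
        * (qpoch_majorant q q ^ 2 / Cmod (qpoch_inf q q)
           * (qpoch_majorant c q ^ 2 / Cmod (qpoch_inf c q))))%R.
assert (HA := qpoch_majorant_pos A q); assert (HB := qpoch_majorant_pos B q).
assert (HM1 := qpoch_majorant_pos q q); assert (HM2 := qpoch_majorant_pos c q).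
assert (Hi1 := proj1 (Cmod_gt_0 _) Hqq); assert (Hi2 := proj1 (Cmod_gt_0 _) Hc).
assert (inv_le : forall d i M : R, (0 < i)%R -> (0 < M)%R -> (i <= d * M ^ 2)%R ->
  (0 < d /\ / d <= M ^ 2 / i)%R).
{ intros d i M Hi HM H.
  assert (HM2' : (0 < M ^ 2)%R) by (apply pow_lt, HM).
  assert (Hd : (0 < d)%R) by nra.
  split; [exact Hd|].
  apply Rmult_le_reg_l with (d * i)%R; [nra|].
  replace (d * i * / d)%R with i by (field; lra).
  replace (d * i * (M ^ 2 / i))%R with (d * M ^ 2)%R by (field; lra); lra. }
split.
- repeat apply Rmult_le_pos; try lra; try apply pow_le; try lra;
    left; apply Rinv_0_lt_compat; assumption.
- intros n j; unfold gauss_term.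
  replace (A * B * (z * q ^ n)) with (c * q ^ n) by (unfold c; ring).
  assert (H1 := qpoch_nat_shift_ge q q 0 j Hq).
  replace (q * q ^ 0) with q in H1 by (simpl; ring).
  assert (H2 := qpoch_nat_shift_ge c q n j Hq).
  apply inv_le in H1; [|assumption..].
  apply inv_le in H2; [|assumption..].
  destruct H1 as [P1 H1], H2 as [P2 H2].
  unfold Cdiv; rewrite Cmod_mult, Cmod_pow, (Cmod_mult z), (Cmod_pow q n).
  apply Rmult_le_compat_r.
  { apply pow_le, Rmult_le_pos; [|apply pow_le]; apply Cmod_ge_0. }
  rewrite !Cmod_mult, Cmod_inv, Cmod_mult, Rinv_mult.
  + apply Rmult_le_compat.
    * apply Rmult_le_pos; apply Cmod_ge_0.
    * apply Rmult_le_pos; left; apply Rinv_0_lt_compat; assumption.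
    * apply Rmult_le_compat; try apply Cmod_ge_0;
        apply qpoch_nat_le_majorant, Hq.
    * apply Rmult_le_compat; try assumption;
        left; apply Rinv_0_lt_compat; assumption.
  + apply Cmult_neq_0; apply Cmod_gt_0; assumption.
Qed.

Lemma ex_series_gauss (A B q z : C) : (Cmod q < 1)%R -> (Cmod z < 1)%R ->
  qpoch_inf (A * B * z) q <> 0 ->
  exists L : C, is_series (gauss_term A B q z) L.
Proof.
intros Hq Hz Hc.
destruct (gauss_term_le A B q z Hq Hc) as [K [HK Hle]].
apply (ex_series_le (K := C_AbsRing) (V := C_CompleteNormedModule) _
         (fun j => K * Cmod z ^ j)%R).
- intros j; specialize (Hle 0%nat j); simpl in Hle.
  rewrite Rmult_1_r, Cmult_1_r in Hle; exact Hle.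
- apply (ex_series_scal_l (K := R_AbsRing) K (fun j => Cmod z ^ j)%R).
  apply ex_series_geom; rewrite Rabs_pos_eq; [exact Hz|apply Cmod_ge_0].
Qed.

Lemma is_series_term_lim (f : nat -> C) (L : C) :
  is_series f L -> is_lim_seq (fun n => Cmod (f (S n))) 0%R.
Proof.
intros H.
assert (H0 : filterlim (sum_n f) eventually (locally L)) by exact H.
apply filterlim_Cmod_iff in H0.
apply is_lim_seq_le_le with (u := fun _ => 0%R)
  (w := fun n => (Cmod (sum_n f (S n) - L) + Cmod (sum_n f n - L))%R).
- intros n; split; [apply Cmod_ge_0|].
  rewrite sum_Sn; change plus with Cplus.
  rewrite <- (Cmod_opp (sum_n f n - L)).
  eapply Rle_trans; [|apply Cmod_triangle]; right; f_equal; ring.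
- apply is_lim_seq_const.
- replace (Finite 0) with (Finite (0 + 0)) by (f_equal; ring).
  apply is_lim_seq_plus'; [|exact H0].
  exact (proj1 (is_lim_seq_incr_1 (fun n => Cmod (sum_n f n - L)) _) H0).
Qed.

(** The boundary term of the telescoped partial sums is at most a constant
    times |f_(N+1)|, which vanishes in the limit because the series
    converges. *)
Lemma gauss_sum_contiguous (A B q z L L' : C) : (Cmod q < 1)%R ->
  qpoch_inf (A * B * z) q <> 0 ->
  is_series (gauss_term A B q z) L ->
  is_series (gauss_term A B q (z * q)) L' ->
  (1 - A * B * z) * (1 - z) * L = (1 - A * z) * (1 - B * z) * L'.
Proof.
intros Hq Hc HS HS'.
assert (HT := is_series_term_lim _ _ HS).
assert (H1 : filterlim (sum_n (gauss_term A B q z)) eventually (locally L))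
  by exact HS.
assert (H2 : filterlim (sum_n (gauss_term A B q (z * q))) eventually (locally L'))
  by exact HS'.
set (k := (1 - A * B * z) * (1 - z)); set (k' := (1 - A * z) * (1 - B * z)).
apply filterlim_Cmod_iff in H1; apply filterlim_Cmod_iff in H2.
assert (HL : (Cmod (k * L - k' * L') <= 0)%R).
{ refine (is_lim_seq_le (fun _ => Cmod (k * L - k' * L'))
   (fun N => Cmod k * Cmod (sum_n (gauss_term A B q z) N - L)
     + Cmod k' * Cmod (sum_n (gauss_term A B q (z * q)) N - L')
     + Cmod (1 - A * B * z) * 2 * Cmod (gauss_term A B q z (S N)))%R
   _ 0%R _ (is_lim_seq_const _) _).
  - intros N.
    assert (HP := gauss_partial_sum_contiguous A B q z N Hq Hc).
    fold k k' in HP.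
    set (s := sum_n (gauss_term A B q z) N) in *.
    set (s' := sum_n (gauss_term A B q (z * q)) N) in *.
    set (f := gauss_term A B q z (S N)) in *.
    clearbody s s'; change C in s, s'.
    assert (Hp2 : (Cmod (1 - q ^ S N) <= 2)%R).
    { unfold Cminus; eapply Rle_trans; [apply Cmod_triangle|].
      rewrite Cmod_1, Cmod_opp, Cmod_pow.
      assert (H := Cmod_pow_le_1 q (S N) Hq); lra. }
    replace (k * L - k' * L')
      with (- (k * (s - L)) + k' * (s' - L') + (k * s - k' * s')) by ring.
    rewrite HP.
    eapply Rle_trans; [apply Cmod_triangle|].
    apply Rplus_le_compat.
    + eapply Rle_trans; [apply Cmod_triangle|].
      rewrite Cmod_opp, !Cmod_mult; lra.
    + rewrite Cmod_mult, Cmod_opp, Cmod_mult.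
      apply Rmult_le_compat_r; [apply Cmod_ge_0|].
      apply Rmult_le_compat_l; [apply Cmod_ge_0|exact Hp2].
  - replace (Finite 0)
      with (Finite (Cmod k * 0 + Cmod k' * 0 + Cmod (1 - A * B * z) * 2 * 0))
      by (f_equal; ring).
    repeat apply is_lim_seq_plus'; apply is_lim_seq_mult';
      first [apply is_lim_seq_const|assumption]. }
assert (HE : k * L - k' * L' = 0).
{ apply Cmod_eq_0; assert (H0 := Cmod_ge_0 (k * L - k' * L')); lra. }
replace (k * L) with (k * L - k' * L' + k' * L') by ring; rewrite HE; ring.
Qed.

Lemma gauss_conditions_shift (A B q z : C) (n : nat) :
  (Cmod q < 1)%R -> (Cmod z < 1)%R -> qpoch_inf (A * B * z) q <> 0 ->
  (Cmod (z * q ^ n) < 1)%R /\ qpoch_inf (A * B * (z * q ^ n)) q <> 0.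
Proof.
intros Hq Hz Hc; split.
- rewrite Cmod_mult, Cmod_pow.
  assert (H := Cmod_ge_0 z); assert (Hn := Cmod_pow_le_1 q n Hq); nra.
- intros H; apply Hc; rewrite (qpoch_inf_split _ q n Hq).
  replace (A * B * z * q ^ n) with (A * B * (z * q ^ n)) by ring.
  rewrite H; ring.
Qed.

(** Existence of the sum at every intermediate point [z * q ^ i] is what lets
    the induction chain the contiguous relation. *)
Lemma gauss_sum_iterate (A B q z : C) (n : nat) (L Ln : C) :
  (Cmod q < 1)%R -> (Cmod z < 1)%R -> qpoch_inf (A * B * z) q <> 0 ->
  is_series (gauss_term A B q z) L ->
  is_series (gauss_term A B q (z * q ^ n)) Ln ->
  qpoch_nat (A * B * z) q n * qpoch_nat z q n * L
  = qpoch_nat (A * z) q n * qpoch_nat (B * z) q n * Ln.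
Proof.
intros Hq Hz Hc HS; revert Ln; induction n as [|n IH]; intros Ln HSn.
- replace (z * q ^ 0) with z in HSn by (simpl; ring).
  assert (E : L = Ln) by exact (filterlim_locally_unique
    (K := C_AbsRing) (V := C_NormedModule) _ _ _ HS HSn).
  rewrite E; simpl; ring.
- destruct (gauss_conditions_shift A B q z n Hq Hz Hc) as [Hzn Hcn].
  destruct (ex_series_gauss A B q (z * q ^ n) Hq Hzn Hcn) as [L' HS'].
  replace (z * q ^ S n) with (z * q ^ n * q) in HSn
    by (simpl; ring).
  assert (H := gauss_sum_contiguous _ _ _ _ _ _ Hq Hcn HS' HSn).
  specialize (IH L' HS'); simpl.
  transitivity (qpoch_nat (A * B * z) q n * qpoch_nat z q n * L
    * ((1 - A * B * (z * q ^ n)) * (1 - z * q ^ n))); [ring|].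
  rewrite IH.
  transitivity (qpoch_nat (A * z) q n * qpoch_nat (B * z) q n
    * ((1 - A * B * (z * q ^ n)) * (1 - z * q ^ n) * L')); [ring|].
  rewrite H; ring.
Qed.

(** With r proportional to |q|^n this forces the sum at z q^n towards its
    first term. *)
Lemma is_series_sub_head_le (f : nat -> C) (L : C) (K r : R) :
  (0 <= r < 1)%R -> (0 <= K)%R -> (forall j, Cmod (f j) <= K * r ^ j)%R ->
  is_series f L -> (Cmod (L - f O) <= K * r / (1 - r))%R.
Proof.
intros Hr HK Hf HS.
apply filterlim_Cmod_le with (u := sum_n f); [exact HS|].
intros N; apply Rle_trans with (K * r * (1 - r ^ N) / (1 - r))%R.
- induction N as [|N IH].
  + rewrite sum_O; replace (f O - f O) with (0 : C) by ring.
    rewrite Cmod_0; simpl; right; field; lra.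
  + rewrite sum_Sn; change plus with Cplus.
    replace (sum_n f N + f (S N) - f O)
      with (sum_n f N - f O + f (S N)) by ring.
    eapply Rle_trans; [apply Cmod_triangle|].
    eapply Rle_trans; [apply Rplus_le_compat; [exact IH|apply Hf]|].
    right; simpl; field; lra.
- apply geom_partial_le; [apply Rmult_le_pos|]; lra.
Qed.

(** The sequences [u] and [v] below are the two sides of the iterated relation
    with the sum at z q^n replaced by its limit 1; they differ by O(|q|^n). *)
Lemma gauss_sum_mul (A B q z L : C) :
  (Cmod q < 1)%R -> (Cmod z < 1)%R -> qpoch_inf (A * B * z) q <> 0 ->
  is_series (gauss_term A B q z) L ->
  qpoch_inf (A * B * z) q * qpoch_inf z q * L
  = qpoch_inf (A * z) q * qpoch_inf (B * z) q.
Proof.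
intros Hq Hz Hc HS.
destruct (gauss_term_le A B q z Hq Hc) as [K [HK Hle]].
assert (H0q := Cmod_ge_0 q); assert (H0z := Cmod_ge_0 z).
set (u := fun n => qpoch_nat (A * B * z) q n * qpoch_nat z q n * L).
set (v := fun n => qpoch_nat (A * z) q n * qpoch_nat (B * z) q n).
assert (Hu : filterlim u eventually
  (locally (qpoch_inf (A * B * z) q * qpoch_inf z q * L))).
{ repeat apply filterlim_Cmult; try apply qpoch_inf_correct, Hq.
  apply filterlim_const. }
assert (Hv : filterlim v eventually
  (locally (qpoch_inf (A * z) q * qpoch_inf (B * z) q))).
{ apply filterlim_Cmult; apply qpoch_inf_correct, Hq. }
set (M := (qpoch_majorant (A * z) q * qpoch_majorant (B * z) q)%R).
assert (Huv : forall n, (Cmod (u n - v n)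
  <= M * (K * Cmod z / (1 - Cmod z)) * Cmod q ^ n)%R).
{ intros n.
  assert (Hp := Cmod_pow_le_1 q n Hq).
  destruct (gauss_conditions_shift A B q z n Hq Hz Hc) as [Hzn Hcn].
  destruct (ex_series_gauss A B q (z * q ^ n) Hq Hzn Hcn) as [Ln HSn].
  unfold u; rewrite (gauss_sum_iterate A B q z n L Ln Hq Hz Hc HS HSn).
  fold (v n).
  replace (v n * Ln - v n) with (v n * (Ln - 1)) by ring.
  rewrite Cmod_mult, Rmult_assoc.
  apply Rmult_le_compat; try apply Cmod_ge_0.
  - unfold v; rewrite Cmod_mult.
    apply Rmult_le_compat; try apply Cmod_ge_0;
      apply qpoch_nat_le_majorant, Hq.
  - rewrite <- (gauss_term_0 A B q (z * q ^ n)).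
    assert (Hr : (0 <= Cmod z * Cmod q ^ n <= Cmod z)%R) by (split; nra).
    eapply Rle_trans;
      [exact (is_series_sub_head_le _ _ K (Cmod z * Cmod q ^ n)%R
               ltac:(lra) HK (Hle n) HSn)|].
    replace (K * Cmod z / (1 - Cmod z) * Cmod q ^ n)%R
      with (K * (Cmod z * Cmod q ^ n) * / (1 - Cmod z))%R by (field; lra).
    apply Rmult_le_compat_l; [apply Rmult_le_pos; lra|].
    apply Rinv_le_contravar; lra. }
assert (HD : is_lim_seq (fun n => Cmod (u n - v n)) 0%R).
{ apply is_lim_seq_le_le with (u := fun _ => 0%R)
    (w := fun n => (M * (K * Cmod z / (1 - Cmod z)) * Cmod q ^ n)%R).
  - intros n; split; [apply Cmod_ge_0|apply Huv].
  - apply is_lim_seq_const.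
  - replace (Finite 0) with (Finite (M * (K * Cmod z / (1 - Cmod z)) * 0))
      by (f_equal; ring).
    apply is_lim_seq_mult'; [apply is_lim_seq_const|].
    apply is_lim_seq_geom; rewrite Rabs_pos_eq; lra. }
apply (filterlim_locally_unique (K := C_AbsRing) (V := C_NormedModule)
         (F := eventually) u); [exact Hu|].
apply filterlim_Cmod_iff; apply filterlim_Cmod_iff in Hv.
apply is_lim_seq_le_le with (u := fun _ => 0%R)
  (w := fun n => (Cmod (u n - v n)
    + Cmod (v n - qpoch_inf (A * z) q * qpoch_inf (B * z) q))%R).
- intros n; split; [apply Cmod_ge_0|].
  eapply Rle_trans; [|apply Cmod_triangle]; right; f_equal; ring.
- apply is_lim_seq_const.
- replace (Finite 0) with (Finite (0 + 0)) by (f_equal; ring).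
  apply is_lim_seq_plus'; assumption.
Qed.

(** In terms of C = ABz, for nonzero A and B, the value is the familiar
    (C/A)_oo (C/B)_oo / ((C)_oo (C/(AB))_oo). *)
Theorem q_gauss_sum (A B q z : C) :
  (Cmod q < 1)%R -> (Cmod z < 1)%R -> qpoch_inf (A * B * z) q <> 0 ->
  is_series (gauss_term A B q z)
    (qpoch_inf (A * z) q * qpoch_inf (B * z) q
     / (qpoch_inf (A * B * z) q * qpoch_inf z q)).
Proof.
intros Hq Hz Hc.
destruct (ex_series_gauss A B q z Hq Hz Hc) as [L HS].
rewrite <- (gauss_sum_mul A B q z L Hq Hz Hc HS).
replace (qpoch_inf (A * B * z) q * qpoch_inf z q * L
         / (qpoch_inf (A * B * z) q * qpoch_inf z q)) with L; [exact HS|].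
field; split; [apply qpoch_inf_neq0; assumption|exact Hc].
Qed.

(** * Reduction of the bilateral sum *)

Lemma Cpowz_sub (z : C) (j m : nat) : z <> 0 ->
  Cpowz z (Z.of_nat j - Z.of_nat m) = z ^ j / z ^ m.
Proof.
intros Hz; unfold Cpowz.
destruct (Z.leb_spec 0 (Z.of_nat j - Z.of_nat m)) as [H|H].
- replace (z ^ j) with (z ^ (m + (j - m))) by (f_equal; lia).
  rewrite Cpow_add_r.
  replace (Z.to_nat (Z.of_nat j - Z.of_nat m)) with (j - m)%nat by lia.
  field; apply Cpow_nz, Hz.
- replace (z ^ m) with (z ^ (j + (m - j))) by (f_equal; lia).
  rewrite Cpow_add_r.
  replace (Z.to_nat (- (Z.of_nat j - Z.of_nat m))) with (m - j)%nat by lia.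
  field; split; apply Cpow_nz, Hz.
Qed.

(** Both signs of j - m follow from splitting the longer of the products
    (y)_j and (y)_m at the length of the shorter. *)
Lemma qpoch_sub (y q : C) (j m : nat) : q <> 0 -> qpoch_nat y q m <> 0 ->
  qpoch (y * q ^ m) q (Z.of_nat j - Z.of_nat m)
  = qpoch_nat y q j / qpoch_nat y q m.
Proof.
intros Hq Hy; unfold qpoch.
destruct (Z.leb_spec 0 (Z.of_nat j - Z.of_nat m)) as [H|H].
- replace (Z.to_nat (Z.of_nat j - Z.of_nat m)) with (j - m)%nat by lia.
  replace (qpoch_nat y q j) with (qpoch_nat y q (m + (j - m)))
    by (f_equal; lia).
  rewrite qpoch_nat_add; field; exact Hy.
- rewrite Cpowz_sub by exact Hq.
  replace (y * q ^ m * (q ^ j / q ^ m)) with (y * q ^ j)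
    by (field; apply Cpow_nz, Hq).
  replace (Z.to_nat (- (Z.of_nat j - Z.of_nat m))) with (m - j)%nat by lia.
  replace (qpoch_nat y q m) with (qpoch_nat y q (j + (m - j))) in Hy |- *
    by (f_equal; lia).
  rewrite qpoch_nat_add in Hy |- *.
  field; split; intros E; apply Hy; rewrite E; ring.
Qed.

(** Factor by factor, 1 - x/q^i = - (x/q^i) (1 - q^i/x) for 1 <= i <= m; the
    powers of q collect to q^(m(m+1)/2). *)
Lemma qpoch_nat_reflect (x q : C) (m : nat) : x <> 0 -> q <> 0 ->
  qpoch_nat (x / q ^ m) q m * q ^ (m * S m / 2)
  = (- x) ^ m * qpoch_nat (q / x) q m.
Proof.
intros Hx Hq; induction m as [|m IH].
- simpl; ring.
- replace (S m * S (S m) / 2)%nat with (m * S m / 2 + S m)%nat.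
  2:{ rewrite <- Nat.div_add by lia; f_equal; lia. }
  change (qpoch_nat (x / q ^ S m) q (S m))
    with (qpoch_nat (x / q ^ S m) q (1 + m)).
  rewrite qpoch_nat_add.
  replace (x / q ^ S m * q ^ 1) with (x / q ^ m)
    by (simpl; field; split; [apply Cpow_nz|]; exact Hq).
  rewrite Cpow_add_r.
  transitivity (qpoch_nat (x / q ^ m) q m * q ^ (m * S m / 2)
    * (qpoch_nat (x / q ^ S m) q 1 * q ^ S m)); [ring|].
  rewrite IH; simpl; field.
  split; [exact Hx|split; [apply Cpow_nz|]; exact Hq].
Qed.

Theorem proposition2p1 (q : C) (m : nat) (a b z : C)
  (hq0 : q <> 0) (hq : (Cmod q < 1)%R)
  (ha : a <> 0) (hz0 : z <> 0)
  (hb : qpoch_inf b q <> 0)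
  (hb_neg : forall n : nat, (n <= m)%nat ->
     qpoch (b * Cpowz q (- Z.of_nat n)) q (Z.of_nat n) <> 0)
  (hqa : qpoch (q / a) q (Z.of_nat m) <> 0)
  (hbaz : qpoch (b / (a * z)) q (Z.of_nat m) <> 0)
  (hz : (Cmod z < 1)%R) :
  is_series
    (fun j : nat =>
       let k := (Z.of_nat j - Z.of_nat m)%Z in
       (qpoch a q k * qpoch (b * q ^ m / (a * z)) q k)
       / (qpoch (q ^ (1 + m)) q k * qpoch b q k) * Cpowz z k)
    ((qpoch q q (Z.of_nat m) * qpoch (q / (a * z)) q (Z.of_nat m))
     / (qpoch (q / a) q (Z.of_nat m) * qpoch (b / (a * z)) q (Z.of_nat m))
     * ((qpoch_inf (b / a) q * qpoch_inf (a * z) q)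
        / (qpoch_inf b q * qpoch_inf z q))).
Proof.
assert (Hqm : q ^ m <> 0) by (apply Cpow_nz, hq0).
assert (Hnat : forall x, qpoch x q (Z.of_nat m) = qpoch_nat x q m).
{ intros x; unfold qpoch; rewrite (proj2 (Z.leb_le _ _)) by lia.
  now rewrite Nat2Z.id. }
specialize (hb_neg m (Nat.le_refl m)).
rewrite Hnat in hb_neg; rewrite !Hnat; rewrite Hnat in hqa, hbaz.
replace (b * Cpowz q (- Z.of_nat m)) with (b / q ^ m) in hb_neg.
2:{ change (- Z.of_nat m)%Z with (Z.of_nat 0 - Z.of_nat m)%Z.
    rewrite Cpowz_sub by exact hq0; simpl; field; exact Hqm. }
assert (Hbm : b / q ^ m * q ^ m = b) by (field; exact Hqm).
assert (Hc : qpoch_inf (b / q ^ m) q <> 0).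
{ rewrite (qpoch_inf_split _ q m hq), Hbm; apply Cmult_neq_0; assumption. }
assert (Hqqm := qpoch_nat_neq0 q q m hq (qpoch_inf_neq0 q q hq hq)).
assert (Haz : a * z <> 0) by (apply Cmult_neq_0; assumption).
assert (Rz := qpoch_nat_reflect (a * z) q m Haz hq0).
assert (Ra := qpoch_nat_reflect a q m ha hq0).
assert (HT : q ^ (m * S m / 2) <> 0) by (apply Cpow_nz, hq0).
assert (Hzm : z ^ m <> 0) by (apply Cpow_nz, hz0).
assert (Ham : (- a) ^ m <> 0).
{ apply Cpow_nz; intros E; apply ha.
  replace a with (- - a) by ring; rewrite E; ring. }
assert (Hanz : qpoch_nat (a / q ^ m) q m <> 0).
{ intros E; rewrite E, Cmult_0_l in Ra; symmetry in Ra; revert Ra.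
  apply Cmult_neq_0; assumption. }
assert (Hcm : a / q ^ m * (b / (a * z)) * z = b / q ^ m)
  by (field; repeat split; assumption).
(* P is the term of index k = -m, the first one of the shifted series. *)
set (P := qpoch_nat q q m * qpoch_nat (b / q ^ m) q m
          / (qpoch_nat (a / q ^ m) q m * qpoch_nat (b / (a * z)) q m * z ^ m)).
assert (HG := q_gauss_sum (a / q ^ m) (b / (a * z)) q z hq hz).
rewrite Hcm in HG; specialize (HG Hc).
apply (is_series_scal P) in HG.
match type of HG with is_series _ ?l => match goal with |- is_series _ ?r =>
  replace r with l end end.
- eapply is_series_ext; [|exact HG].
  intros j; cbv zeta; change scal with Cmult.
  rewrite Cpowz_sub by exact hz0.
  replace (b * q ^ m / (a * z)) with (b / (a * z) * q ^ m)
    by (field; split; assumption).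
  replace (q ^ (1 + m)) with (q * q ^ m) by (simpl; ring).
  rewrite (qpoch_sub (b / (a * z)) q j m hq0 hbaz).
  rewrite (qpoch_sub q q j m hq0 Hqqm).
  replace (qpoch b q (Z.of_nat j - Z.of_nat m))
    with (qpoch (b / q ^ m * q ^ m) q (Z.of_nat j - Z.of_nat m))
    by (f_equal; exact Hbm).
  rewrite (qpoch_sub (b / q ^ m) q j m hq0 hb_neg).
  replace (qpoch a q (Z.of_nat j - Z.of_nat m))
    with (qpoch (a / q ^ m * q ^ m) q (Z.of_nat j - Z.of_nat m))
    by (f_equal; field; exact Hqm).
  rewrite (qpoch_sub (a / q ^ m) q j m hq0 Hanz).
  unfold P, gauss_term; rewrite Hcm.
  (* [field] recognises the equation only at the type C itself. *)
  match goal with |- ?x = ?y => change (@eq C x y) end.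
  field; repeat split; try assumption.
  + apply (qpoch_nat_neq0 _ _ _ hq Hc).
  + apply (qpoch_nat_neq0 _ _ _ hq (qpoch_inf_neq0 q q hq hq)).
- change scal with Cmult.
  replace (b / (a * z) * z) with (b / a) by (field; split; assumption).
  replace (a / q ^ m * z) with (a * z / q ^ m) by (field; assumption).
  rewrite (qpoch_inf_split (a * z / q ^ m) q m hq).
  rewrite (qpoch_inf_split (b / q ^ m) q m hq), Hbm.
  replace (a * z / q ^ m * q ^ m) with (a * z) by (field; exact Hqm).
  assert (Ea : qpoch_nat (a / q ^ m) q m
    = (- a) ^ m * qpoch_nat (q / a) q m / q ^ (m * S m / 2)).
  { rewrite <- Ra; field; exact HT. }
  assert (Ez : qpoch_nat (a * z / q ^ m) q m
    = (- a) ^ m * z ^ m * qpoch_nat (q / (a * z)) q m / q ^ (m * S m / 2)).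
  { rewrite <- Cpow_mult_l; replace (- a * z) with (- (a * z)) by ring.
    rewrite <- Rz; field; exact HT. }
  unfold P; rewrite Ea, Ez.
  match goal with |- ?x = ?y => change (@eq C x y) end.
  field; repeat split; try assumption.
  apply qpoch_inf_neq0; assumption.
Qed.
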